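(* Let $w,c,d,\mathit{ch},b,t\ge 0$ be real numbers with $w\ge c$ and $\mathit{ch}>2w$, and put $z=w-c+d-\mathit{ch}$. If $d>c+\mathit{ch}$, $b<c$, $t>z+d-b$ and the two players are rational, then Game 2 always terminates at $v_{10}$; that is, in every sequential equilibrium of Game 2 the terminal node $v_{10}$ is reached with probability $1$.
   Context: Conventions. Games are finite two-player extensive-form games with imperfect information. A behavior strategy $s_i$ of player $i$ assigns to each information set of $i$ a probability distribution over the actions available there (independently across information sets); it is completely mixed if all actions get positive probability. A belief system $\beta$ assigns to each information set a probability distribution over its nodes. An assessment is a pair $(s,\beta)$ with $s=(s_1,s_2)$ a profile of behavior strategies. Player $i$'s expected payoff at a node $h$ is $u_i(s;h)=\sum_{\zeta}\Pr[\zeta\mid(s,h)]\,u_i(\zeta)$ (sum over terminal nodes $\zeta$), and at an information set $\mathcal I$ of player $i$ it is $u_i(s;\mathcal I,\beta)=\sum_{h\in\mathcal I}\beta(h)u_i(s;h)$. $(s,\beta)$ is sequentially rational if $u_i(s;\mathcal I,\beta)\ge u_i((s_i',s_{-i});\mathcal I,\beta)$ for every player $i$, every information set $\mathcal I$ of $i$ and every behavior strategy $s_i'$ of $i$. It is consistent if there are completely mixed profiles $s^k\to s$ such that the beliefs $\beta^k$ induced by $s^k$ via Bayes' rule converge to $\beta$. A sequential equilibrium is an assessment that is sequentially rational and consistent. Rational players play according to a sequential equilibrium, and ''always terminates at a node'' means that the node is reached with probability $1$. The symbol $\mathit{ch}$ is a single real parameter; action labels such as $f(x), r, other$ are formal symbols.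 Game 2. Players LDR (utility $u_1$) and FLR (utility $u_2$). At the root $v_0$, LDR chooses $\neg init$ (to a terminal node with payoffs $(w-c,w-c)$) or $init$ (to $v_1$). At $v_1$, FLR chooses $\neg collude$ (to a terminal node with payoffs $(w-c,w-c)$) or $collude$ (to $v_2$). (These two terminal nodes stand for the play of another game, whose equilibrium payoffs are $(w-c,w-c)$.) At $v_2$, LDR chooses $f(x)$ (to $v_3$), $r$ (to $v_4$) or $other$ (to $v_5$). Then FLR moves with actions $f(x),r,other$, leading, in this order, from $v_3$ to $v_6,v_7,v_8$; from $v_4$ to $v_9,v_{10},v_{11}$; from $v_5$ to $v_{12},v_{13},v_{14}$ (terminal nodes). Information sets: $\mathcal I_{1,1}=\{v_0\}$, $\mathcal I_{1,2}=\{v_2\}$ for LDR; $\mathcal I_{2,1}=\{v_1\}$, $\mathcal I_{2,2}=\{v_3,v_4,v_5\}$ for FLR. Payoffs $(u_1,u_2)$: $v_6:(w-c,\,w-c)$; $v_7:(z-t-b,\,-d+t+b)$; $v_8:(z,\,-d)$; $v_9:(-d+t,\,z-t)$; $v_{10}:(w-b,\,w+b)$; $v_{11}:(-d+t,\,-d-t)$; $v_{12}:(-d,\,z)$; $v_{13}:(-d-t-b,\,-d+t+b)$; $v_{14}:(-d,\,-d)$. *)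

(* Defs.v *)
From HB Require Import structures.
From mathcomp Require Import all_boot all_order all_algebra.
From mathcomp Require Import all_classical all_reals all_analysis.

Set Implicit Arguments.
Unset Strict Implicit.
Unset Printing Implicit Defensive.

Import Order.TTheory GRing.Theory Num.Theory.
Import numFieldNormedType.Exports.
Local Open Scope classical_set_scope.
Local Open Scope ring_scope.

Definition player := 'I_2.

(* The tree is given by its edges: [edge v = Some (h, a)] means that action [a]
   at node [h] leads to [v].  Terminal nodes are those with [info v = None];
   [payoff] is irrelevant at the other nodes. *)
Record game (R : realType) := Game {
  node : finType;
  action : finType;
  infoset : player -> finType;
  initial : node;
  edge : node -> option (node * action);
  info : node -> option {i : player & infoset i};
  payoff : player -> node -> R;
  edge_initial : edge initial = None;
  edge_inj : injective edge;
  edge_connected : forall v, exists n,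
    iter n (fun h => oapp fst h (edge h)) v = initial;
  info_terminal : forall v,
    (info v == None) = ~~ [exists a, exists h, edge h == Some (v, a)];
  info_available : forall v h, info v = info h ->
    forall a, [exists k, edge k == Some (v, a)]
            = [exists k, edge k == Some (h, a)];
  infoset_nonempty : forall i (I : infoset i), exists v,
    info v = Some (Tagged infoset I)
}.

Section Equilibrium.
Context {R : realType} {G : game R}.
Implicit Types (i : player) (h v z : node G) (a : action G).

Definition terminal v : bool := info v == None.

Definition mem_infoset i (I : infoset G i) : pred (node G) :=
  fun h => info h == Some (Tagged (infoset G) I).

Definition available i (I : infoset G i) : pred (action G) :=
  fun a => [exists h, mem_infoset I h && [exists v, edge v == Some (h, a)]].

Definition is_distribution (T : finType) (A : pred T) (p : T -> R) : Prop :=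
  [/\ forall x, 0 <= p x, forall x, ~~ A x -> p x = 0 & \sum_x p x = 1].

Definition behavior i := infoset G i -> action G -> R.

Definition is_behavior i (si : behavior i) : Prop :=
  forall I, is_distribution (available I) (si I).

Definition completely_mixed i (si : behavior i) : Prop :=
  forall I a, available I a -> 0 < si I a.

Definition profile := forall i, behavior i.

Definition beliefs := forall i, infoset G i -> node G -> R.

Definition is_beliefs (beta : beliefs) : Prop :=
  forall i (I : infoset G i), is_distribution (mem_infoset I) (beta i I).

Definition move_prob (s : profile) h a : R :=
  if info h is Some u then s (tag u) (tagged u) a else 0.

(* [reach s h v] is the probability that play started at [h] visits [v]: the
   product of the move probabilities on the path from [h] to [v], and 0 if [v]
   is not below [h].  No path is longer than the number of nodes. *)
Fixpoint reach_rec (n : nat) (s : profile) h v : R :=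
  if v == h then 1
  else if n is m.+1 then
    if edge v is Some (k, a) then reach_rec m s h k * move_prob s k a else 0
  else 0.

Definition reach (s : profile) h v : R := reach_rec #|node G| s h v.

Definition node_utility (s : profile) i h : R :=
  \sum_(z | terminal z) reach s h z * payoff i z.

Definition utility (s : profile) (beta : beliefs) i (I : infoset G i) : R :=
  \sum_(h | mem_infoset I h) beta i I h * node_utility s i h.

(* [dfwith s i si] is the profile (s_i', s_{-i}). *)
Definition sequentially_rational (s : profile) (beta : beliefs) : Prop :=
  forall i (I : infoset G i) (si : behavior i), is_behavior si ->
    utility (dfwith s i si) beta I <= utility s beta I.

Definition bayes_beliefs (s : profile) : beliefs := fun i I h =>
  if mem_infoset I h
  then reach s (initial G) h / \sum_(k | mem_infoset I k) reach s (initial G) k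
  else 0.

Definition consistent (s : profile) (beta : beliefs) : Prop :=
  exists sk : nat -> profile,
    [/\ forall k i, is_behavior (sk k i) /\ completely_mixed (sk k i),
        forall i (I : infoset G i) a, sk k i I a @[k --> \oo] --> s i I a
      & forall i (I : infoset G i) h,
          bayes_beliefs (sk k) I h @[k --> \oo] --> beta i I h].

Definition sequential_equilibrium (s : profile) (beta : beliefs) : Prop :=
  [/\ forall i, is_behavior (s i), is_beliefs beta,
      sequentially_rational s beta & consistent s beta].

End Equilibrium.

Arguments profile {R} G.
Arguments beliefs {R} G.

Definition LDR : player := ord0.
Definition FLR : player := ord_max.

(* [v_not_init] and [v_not_collude] are the two terminal nodes that are not
   numbered. *)
Inductive node2 :=
  | v0 | v1 | v2 | v3 | v4 | v5 | v6 | v7 | v8 | v9 | v10 | v11 | v12 | v13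
  | v14 | v_not_init | v_not_collude.

Definition nodes2 : seq node2 :=
  [:: v0; v1; v2; v3; v4; v5; v6; v7; v8; v9; v10; v11; v12; v13; v14;
      v_not_init; v_not_collude].

Definition node2_code (v : node2) : nat :=
  match v with
  | v0 => 0 | v1 => 1 | v2 => 2 | v3 => 3 | v4 => 4 | v5 => 5 | v6 => 6
  | v7 => 7 | v8 => 8 | v9 => 9 | v10 => 10 | v11 => 11 | v12 => 12
  | v13 => 13 | v14 => 14 | v_not_init => 15 | v_not_collude => 16
  end%N.

Lemma node2_codeK : pcancel node2_code (onth nodes2).
Proof. by case. Qed.

HB.instance Definition _ := Countable.copy node2 (pcan_type node2_codeK).

Lemma nodes2P : Finite.axiom nodes2.
Proof. by case. Qed.

HB.instance Definition _ := fintype.isFinite.Build node2 nodes2P.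

(* [act_f] is the action f(x). *)
Inductive action2 :=
  | act_not_init | act_init | act_not_collude | act_collude
  | act_f | act_r | act_other.

Definition actions2 : seq action2 :=
  [:: act_not_init; act_init; act_not_collude; act_collude;
      act_f; act_r; act_other].

Definition action2_code (a : action2) : nat :=
  match a with
  | act_not_init => 0 | act_init => 1 | act_not_collude => 2 | act_collude => 3
  | act_f => 4 | act_r => 5 | act_other => 6
  end%N.

Lemma action2_codeK : pcancel action2_code (onth actions2).
Proof. by case. Qed.

HB.instance Definition _ := Countable.copy action2 (pcan_type action2_codeK).

Lemma actions2P : Finite.axiom actions2.
Proof. by case. Qed.

HB.instance Definition _ := fintype.isFinite.Build action2 actions2P.

Definition edge2 (v : node2) : option (node2 * action2) :=
  match v with
  | v0 => None
  | v_not_init => Some (v0, act_not_init)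
  | v1 => Some (v0, act_init)
  | v_not_collude => Some (v1, act_not_collude)
  | v2 => Some (v1, act_collude)
  | v3 => Some (v2, act_f)
  | v4 => Some (v2, act_r)
  | v5 => Some (v2, act_other)
  | v6 => Some (v3, act_f)
  | v7 => Some (v3, act_r)
  | v8 => Some (v3, act_other)
  | v9 => Some (v4, act_f)
  | v10 => Some (v4, act_r)
  | v11 => Some (v4, act_other)
  | v12 => Some (v5, act_f)
  | v13 => Some (v5, act_r)
  | v14 => Some (v5, act_other)
  end.

(* Each player has two information sets: [ord0 : infoset2 i] is I_{i,1} and
   [ord_max : infoset2 i] is I_{i,2}. *)
Definition infoset2 (i : player) : finType := 'I_2.

Definition I1 (i : player) : infoset2 i := (ord0 : 'I_2).
Definition I2 (i : player) : infoset2 i := (ord_max : 'I_2).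

Definition info2 (v : node2) : option {i : player & infoset2 i} :=
  match v with
  | v0 => Some (Tagged infoset2 (I1 LDR))
  | v1 => Some (Tagged infoset2 (I1 FLR))
  | v2 => Some (Tagged infoset2 (I2 LDR))
  | v3 | v4 | v5 => Some (Tagged infoset2 (I2 FLR))
  | _ => None
  end.

Section Game2.
Variables (R : realType) (w c d z b t : R).

Definition payoffs2 (v : node2) : R * R :=
  match v with
  | v_not_init | v_not_collude => (w - c, w - c)
  | v6 => (w - c, w - c)
  | v7 => (z - t - b, - d + t + b)
  | v8 => (z, - d)
  | v9 => (- d + t, z - t)
  | v10 => (w - b, w + b)
  | v11 => (- d + t, - d - t)
  | v12 => (- d, z)
  | v13 => (- d - t - b, - d + t + b)
  | v14 => (- d, - d)
  | _ => (0, 0)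
  end.

Definition payoff2 (i : player) (v : node2) : R :=
  if i == LDR then (payoffs2 v).1 else (payoffs2 v).2.

Fact edge2_initial : edge2 v0 = None.
Proof. by []. Qed.

Fact edge2_inj : injective edge2.
Proof. by case; case. Qed.

Fact edge2_connected v : exists n,
  iter n (fun h => oapp fst h (edge2 h)) v = v0.
Proof. by exists 4%N; case: v. Qed.

Let exE (T : finType) (e : seq T) (P : pred T) : (forall x, x \in e) ->
  [exists x, P x] = has P e.
Proof.
move=> eT; apply/existsP/hasP => [[x Px]|[x _ Px]]; last by exists x.
by exists x.
Qed.

Let node2E (P : pred node2) : [exists x, P x] = has P nodes2.
Proof. by apply: exE; case. Qed.

Let action2E (P : pred action2) : [exists x, P x] = has P actions2.
Proof. by apply: exE; case. Qed.

Fact info2_terminal v :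
  (info2 v == None) = ~~ [exists a, exists h, edge2 h == Some (v, a)].
Proof. by rewrite action2E /= !node2E; case: v. Qed.

Fact info2_available v h : info2 v = info2 h -> forall a,
  [exists k, edge2 k == Some (v, a)] = [exists k, edge2 k == Some (h, a)].
Proof.
by move=> vh a; rewrite !node2E; move: vh; case: v; case: h => // _; case: a.
Qed.

Fact infoset2_nonempty i (I : infoset2 i) : exists v,
  info2 v = Some (Tagged infoset2 I).
Proof.
have o2 (j : 'I_2) : j = ord0 \/ j = ord_max.
  by case: j => [[|[|//]] lj]; [left | right]; apply: val_inj.
case: (o2 i) I => -> I; case: (o2 I) => ->; first by exists v0.
- by exists v2.
- by exists v1.
- by exists v3.
Qed.

Definition game2 : game R :=
  @Game R node2 action2 infoset2 v0 edge2 info2 payoff2 edge2_initial edge2_inj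
    edge2_connected info2_terminal info2_available infoset2_nonempty.

End Game2.

(* Main.v *)
(* At I_{2,2} the action r is strictly better than f(x) and other at each of the
   nodes v3, v4, v5, hence under any belief, so FLR plays r there.  Backward
   induction then goes through singleton information sets with a strict optimum
   at each step: LDR plays r at v2 (w - b beats z - t - b and - d - t - b), FLR
   colludes (w + b > w - c) and LDR initiates (w - b > w - c as b < c).  Testing
   the equilibrium against the single strategy "init / collude, then r" at each
   information set is enough. *)
Require Import Defs.
From mathcomp Require Import all_boot all_order all_algebra.
From mathcomp Require Import all_classical all_reals all_analysis.
From mathcomp Require Import ring lra.

Set Implicit Arguments.
Unset Strict Implicit.
Unset Printing Implicit Defensive.

Import Order.TTheory GRing.Theory Num.Theory.
Import numFieldNormedType.Exports.
Local Open Scope ring_scope.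

(** * Computing with the finite type of nodes *)

(** The canonical enumeration and [nodes2] are duplicate-free lists of the same elements, hence
    permutations of each other; on the literal list, sums reduce by computation. *)
Lemma big_node2 (R : nmodType) (F : node2 -> R) :
  \sum_v F v = \sum_(v <- nodes2) F v.
Proof.
apply: perm_big; apply: uniq_perm; rewrite ?index_enum_uniq// => v.
by rewrite mem_index_enum; case: v.
Qed.

Lemma card_node2 : #|{: node2}| = 17%N.
Proof. by rewrite -sum1_card big_node2 unlock. Qed.

Lemma exists_node2 (P : pred node2) : [exists v, P v] = has P nodes2.
Proof.
apply/existsP/hasP => [[v Pv]|[v _ Pv]]; last by exists v.
by exists v => //; case: v {Pv}.
Qed.

(** * Strict optima and convex combinations *)

(** The last hypothesis bounds [p * (y - x) + r * (y - u)] by 0. Both terms are nonnegative, so both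
    vanish, and the strict gaps force [p = r = 0]. In use, [y] is the payoff of a pure deviation and
    the combination is the equilibrium payoff. *)
Lemma strict_best_reply3 (R : realDomainType) (p q r x y u : R) :
  0 <= p -> 0 <= r -> p + q + r = 1 -> x < y -> u < y ->
  y <= p * x + q * y + r * u -> q = 1.
Proof.
move=> p0 r0 pqr xy uy le_y.
have px : 0 <= p * (y - x) by rewrite mulr_ge0// subr_ge0 ltW.
have ru : 0 <= r * (y - u) by rewrite mulr_ge0// subr_ge0 ltW.
have yE : y = (p + q + r) * y by rewrite pqr mul1r.
have /eqP : p * (y - x) = 0 by lra.
have /eqP : r * (y - u) = 0 by lra.
rewrite !mulf_eq0 !subr_eq0 (gt_eqF xy) (gt_eqF uy) !orbF.
by move=> /eqP ? /eqP ?; lra.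
Qed.

Lemma strict_best_reply2 (R : realDomainType) (p q x y : R) :
  0 <= p -> p + q = 1 -> x < y -> y <= p * x + q * y -> q = 1.
Proof.
move=> p0 pq xy le_y.
(* The missing third action gets weight 0 and the value [x], so that [x < y] serves for both strict
   gaps. *)
by apply: (@strict_best_reply3 _ p q 0 x y x) => //; rewrite ?mul0r addr0.
Qed.

(** Some weights may be 0, but not all: if the inequality failed, each weighted gap would vanish,
    and so would [p + q + r]. This compares two actions under an arbitrary belief on three nodes. *)
Lemma ltr_convex3 (R : realDomainType) (p q r x y u x' y' u' : R) :
  0 <= p -> 0 <= q -> 0 <= r -> p + q + r = 1 -> x < x' -> y < y' -> u < u' ->
  p * x + q * y + r * u < p * x' + q * y' + r * u'.
Proof.
move=> p0 q0 r0 pqr xx yy uu; rewrite ltNge; apply/negP => ge_.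
have px : 0 <= p * (x' - x) by rewrite mulr_ge0// subr_ge0 ltW.
have qy : 0 <= q * (y' - y) by rewrite mulr_ge0// subr_ge0 ltW.
have ru : 0 <= r * (u' - u) by rewrite mulr_ge0// subr_ge0 ltW.
have /eqP : p * (x' - x) = 0 by lra.
have /eqP : q * (y' - y) = 0 by lra.
have /eqP : r * (u' - u) = 0 by lra.
rewrite !mulf_eq0 !subr_eq0 (gt_eqF xx) (gt_eqF yy) (gt_eqF uu) !orbF.
by move=> /eqP ? /eqP ? /eqP ?; lra.
Qed.

(** * Distributions, and utilities at information sets *)

Lemma is_distribution_pred1 (R : realType) (T : finType) (A : pred T) x :
  A x -> is_distribution A (fun y => (y == x)%:R : R).
Proof.
move=> Ax; split=> [y|y|]; first exact: ler0n.
- by case: eqVneq => // ->; rewrite Ax.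
- by rewrite (bigD1 x)//= eqxx big1 ?addr0// => y /negPf->.
Qed.

Lemma sum_distribution (R : realType) (T : finType) (A : pred T) (p : T -> R)
    (l : seq T) :
  is_distribution A p -> uniq l -> A =1 mem l -> \sum_(x <- l) p x = 1.
Proof.
move=> [_ p0 <-] ul Al; rewrite big_uniq//; apply: big_rmcond => x xl.
by apply: p0; rewrite Al.
Qed.

Lemma sum_distribution2 (R : realType) (T : finType) (A : pred T) (p : T -> R)
    x y :
  is_distribution A p -> uniq [:: x; y] -> A =1 mem [:: x; y] ->
  p x + p y = 1.
Proof.
by move=> pA us As; rewrite -(sum_distribution pA us As) unlock /= addr0.
Qed.

Lemma sum_distribution3 (R : realType) (T : finType) (A : pred T) (p : T -> R)
    x y u :
  is_distribution A p -> uniq [:: x; y; u] -> A =1 mem [:: x; y; u] ->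
  p x + p y + p u = 1.
Proof.
by move=> pA us As; rewrite -(sum_distribution pA us As) unlock /= addr0 addrA.
Qed.

Lemma utility_seq (R : realType) (G : game R) (s : profile G)
    (beta : beliefs G) i (I : infoset G i) (l : seq (node G)) :
  uniq l -> mem_infoset I =1 mem l ->
  utility s beta I = \sum_(h <- l) beta i I h * node_utility s i h.
Proof. by move=> ul Il; rewrite /utility (eq_bigl _ _ Il) big_uniq. Qed.

(** The belief puts weight 1 on the only node, so it disappears from the utility. *)
Lemma utility_singleton (R : realType) (G : game R) (s : profile G)
    (beta : beliefs G) i (I : infoset G i) h :
  is_beliefs beta -> mem_infoset I =1 mem [:: h] ->
  utility s beta I = node_utility s i h.
Proof.
move=> betaP Ih; rewrite (@utility_seq _ _ _ _ _ _ [:: h])// big_seq1.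
have := sum_distribution (betaP i I) (isT : uniq [:: h]) Ih.
by rewrite big_seq1 => ->; rewrite mul1r.
Qed.

(** * Explicit utilities and information sets of Game 2 *)

Section Game2Utilities.
Variables (R : realType) (w c d z b t : R).
Local Notation G := (game2 w c d z b t).
Implicit Types (s : profile G) (beta : beliefs G) (i : player).

(** The recursion bound becomes the numeral 17, the number of nodes, and the terminal nodes become a
    literal list, so that [reach_rec] unfolds by computation. *)
Lemma node_utilityE s i h : node_utility s i h =
  \sum_(v <- [:: v6; v7; v8; v9; v10; v11; v12; v13; v14; v_not_init;
                 v_not_collude]) reach_rec 17%N s h v * payoff2 w c d z b t i v.
Proof.
rewrite /node_utility /reach [#|_|]card_node2 big_mkcond/= big_node2.
by rewrite -big_mkcond/= -big_filter.
Qed.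

Lemma node_utility_v3 s i : node_utility s i v3 =
  s FLR (I2 FLR) act_f * payoff2 w c d z b t i v6
  + s FLR (I2 FLR) act_r * payoff2 w c d z b t i v7
  + s FLR (I2 FLR) act_other * payoff2 w c d z b t i v8.
Proof. rewrite node_utilityE unlock /= /move_prob /=. ring. Qed.

Lemma node_utility_v4 s i : node_utility s i v4 =
  s FLR (I2 FLR) act_f * payoff2 w c d z b t i v9
  + s FLR (I2 FLR) act_r * payoff2 w c d z b t i v10
  + s FLR (I2 FLR) act_other * payoff2 w c d z b t i v11.
Proof. rewrite node_utilityE unlock /= /move_prob /=. ring. Qed.

Lemma node_utility_v5 s i : node_utility s i v5 =
  s FLR (I2 FLR) act_f * payoff2 w c d z b t i v12
  + s FLR (I2 FLR) act_r * payoff2 w c d z b t i v13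
  + s FLR (I2 FLR) act_other * payoff2 w c d z b t i v14.
Proof. rewrite node_utilityE unlock /= /move_prob /=. ring. Qed.

(** From here on, utilities are expressed through those of the child nodes, so that backward
    induction can substitute values found further down the tree. *)
Lemma node_utility_v2 s i : node_utility s i v2 =
  s LDR (I2 LDR) act_f * node_utility s i v3
  + s LDR (I2 LDR) act_r * node_utility s i v4
  + s LDR (I2 LDR) act_other * node_utility s i v5.
Proof. rewrite !node_utilityE unlock /= /move_prob /=. ring. Qed.

Lemma node_utility_v1 s i : node_utility s i v1 =
  s FLR (I1 FLR) act_not_collude * payoff2 w c d z b t i v_not_collude
  + s FLR (I1 FLR) act_collude * node_utility s i v2.
Proof. rewrite !node_utilityE unlock /= /move_prob /=. ring. Qed.

Lemma node_utility_v0 s i : node_utility s i v0 =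
  s LDR (I1 LDR) act_not_init * payoff2 w c d z b t i v_not_init
  + s LDR (I1 LDR) act_init * node_utility s i v1.
Proof. rewrite !node_utilityE unlock /= /move_prob /=. ring. Qed.

Lemma reach_v10 s : reach s v0 v10 =
  s LDR (I1 LDR) act_init * s FLR (I1 FLR) act_collude
  * s LDR (I2 LDR) act_r * s FLR (I2 FLR) act_r.
Proof. by rewrite /reach [#|_|]card_node2 /= /move_prob /= mul1r. Qed.

Lemma mem_I1_LDR : @mem_infoset R G LDR (I1 LDR) =1 mem [:: v0].
Proof.
by rewrite /mem_infoset; case=> //=; rewrite (inj_eq Some_inj) eq_Tagged.
Qed.

Lemma mem_I1_FLR : @mem_infoset R G FLR (I1 FLR) =1 mem [:: v1].
Proof.
by rewrite /mem_infoset; case=> //=; rewrite (inj_eq Some_inj) eq_Tagged.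
Qed.

Lemma mem_I2_LDR : @mem_infoset R G LDR (I2 LDR) =1 mem [:: v2].
Proof.
by rewrite /mem_infoset; case=> //=; rewrite (inj_eq Some_inj) eq_Tagged.
Qed.

Lemma mem_I2_FLR : @mem_infoset R G FLR (I2 FLR) =1 mem [:: v3; v4; v5].
Proof.
by rewrite /mem_infoset; case=> //=; rewrite (inj_eq Some_inj) eq_Tagged.
Qed.

Lemma available_I1_LDR :
  @available R G LDR (I1 LDR) =1 mem [:: act_not_init; act_init].
Proof.
move=> a; rewrite /available exists_node2 /= !mem_I1_LDR /= !exists_node2.
by case: a.
Qed.

Lemma available_I1_FLR :
  @available R G FLR (I1 FLR) =1 mem [:: act_not_collude; act_collude].
Proof.
move=> a; rewrite /available exists_node2 /= !mem_I1_FLR /= !exists_node2.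
by case: a.
Qed.

Lemma available_I2_LDR :
  @available R G LDR (I2 LDR) =1 mem [:: act_f; act_r; act_other].
Proof.
move=> a; rewrite /available exists_node2 /= !mem_I2_LDR /= !exists_node2.
by case: a.
Qed.

Lemma available_I2_FLR :
  @available R G FLR (I2 FLR) =1 mem [:: act_f; act_r; act_other].
Proof.
move=> a; rewrite /available exists_node2 /= !mem_I2_FLR /= !exists_node2.
by case: a.
Qed.

(** Component [i] is the pure strategy against which player [i] is tested, written as point
    masses. *)
Definition collusion : profile G := fun i I a =>
  (a == if (I : 'I_2) == ord0 then
          if i == LDR then act_init else act_collude
        else act_r)%:R.
Arguments collusion : clear implicits.

Lemma is_behavior_collusion i : @is_behavior R G i (collusion i).
Proof.
have o2 (j : 'I_2) : j = ord0 \/ j = ord_max.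
  by case: j => [[|[|//]] lj]; [left | right]; apply: val_inj.
case: (o2 i) => -> I; case: (o2 I) => ->; apply: is_distribution_pred1 => /=.
- by rewrite available_I1_LDR.
- by rewrite available_I2_LDR.
- by rewrite available_I1_FLR.
- by rewrite available_I2_FLR.
Qed.

Lemma utility_I1_LDR s beta : is_beliefs beta ->
  utility s beta (I1 LDR) = node_utility s LDR v0.
Proof. by move=> betaP; apply: utility_singleton => //; apply: mem_I1_LDR. Qed.

Lemma utility_I1_FLR s beta : is_beliefs beta ->
  utility s beta (I1 FLR) = node_utility s FLR v1.
Proof. by move=> betaP; apply: utility_singleton => //; apply: mem_I1_FLR. Qed.

Lemma utility_I2_LDR s beta : is_beliefs beta ->
  utility s beta (I2 LDR) = node_utility s LDR v2.
Proof. by move=> betaP; apply: utility_singleton => //; apply: mem_I2_LDR. Qed.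

Lemma utility_I2_FLR s beta : utility s beta (I2 FLR) =
  beta FLR (I2 FLR) v3 * node_utility s FLR v3
  + beta FLR (I2 FLR) v4 * node_utility s FLR v4
  + beta FLR (I2 FLR) v5 * node_utility s FLR v5.
Proof.
rewrite (@utility_seq _ G _ _ _ _ [:: v3; v4; v5])//; last exact: mem_I2_FLR.
by rewrite unlock /= addr0 addrA.
Qed.

(** Sequential rationality enters the theorem through this inequality, once per information set. *)
Lemma collusion_best s beta i (I : infoset G i) :
  sequential_equilibrium s beta ->
  utility (dfwith s i (collusion i)) beta I <= utility s beta I.
Proof. by case=> _ _ opt _; apply: opt; apply: is_behavior_collusion. Qed.

End Game2Utilities.

(** * Backward induction along the path to [v10] *)

Theorem theorem6p2 (R : realType) (w c d ch b t z : R)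
  (hw : 0 <= w) (hc : 0 <= c) (hd : 0 <= d) (hch : 0 <= ch) (hb : 0 <= b)
  (ht : 0 <= t) (hwc : c <= w) (hchw : 2 * w < ch)
  (hz : z = w - c + d - ch)
  (hdc : c + ch < d) (hbc : b < c) (htz : z + d - b < t)
  (s : profile (game2 w c d z b t)) (beta : beliefs (game2 w c d z b t))
  (hseq : sequential_equilibrium s beta) :
  reach s (initial (game2 w c d z b t)) v10 = 1.
Proof.
have [sP betaP _ _] := hseq.
have s_ge0 i I a : 0 <= s i I a by case: (sP i I).
have b_ge0 h : 0 <= beta FLR (I2 FLR) h by case: (betaP FLR (I2 FLR)).
have b_sum : beta FLR (I2 FLR) v3 + beta FLR (I2 FLR) v4
    + beta FLR (I2 FLR) v5 = 1.
  by apply: sum_distribution3 (betaP FLR (I2 FLR)) _ _ => //; apply: mem_I2_FLR.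
have sum22 : s FLR (I2 FLR) act_f + s FLR (I2 FLR) act_r
    + s FLR (I2 FLR) act_other = 1.
  by apply: sum_distribution3 (sP _ _) _ _ => //; apply: available_I2_FLR.
have sum12 : s LDR (I2 LDR) act_f + s LDR (I2 LDR) act_r
    + s LDR (I2 LDR) act_other = 1.
  by apply: sum_distribution3 (sP _ _) _ _ => //; apply: available_I2_LDR.
have sum21 : s FLR (I1 FLR) act_not_collude + s FLR (I1 FLR) act_collude = 1.
  by apply: sum_distribution2 (sP _ _) _ _ => //; apply: available_I1_FLR.
have sum11 : s LDR (I1 LDR) act_not_init + s LDR (I1 LDR) act_init = 1.
  by apply: sum_distribution2 (sP _ _) _ _ => //; apply: available_I1_LDR.
have r22 : s FLR (I2 FLR) act_r = 1.
  have := collusion_best (I2 FLR) hseq.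
  rewrite !utility_I2_FLR !node_utility_v3 !node_utility_v4 !node_utility_v5.
  rewrite !dfwithin /collusion /payoff2 /= !mul0r !mul1r !add0r !addr0 => le_r.
  (* Belief averages of FLR's payoffs: r and other each pay the same at [v3] and [v5], hence [u];
     f(x) pays [z] at [v5], hence [u']. *)
  pose u x y := beta FLR (I2 FLR) v3 * x + beta FLR (I2 FLR) v4 * y
    + beta FLR (I2 FLR) v5 * x.
  pose u' x y := beta FLR (I2 FLR) v3 * x + beta FLR (I2 FLR) v4 * y
    + beta FLR (I2 FLR) v5 * z.
  apply: (@strict_best_reply3 _ (s FLR (I2 FLR) act_f) _
    (s FLR (I2 FLR) act_other) (u' (w - c) (z - t)) (u (- d + t + b) (w + b))
    (u (- d) (- d - t))) => //.
  (* r beats f(x): [hdc] and [hz] give [w < z], and [htz] gives [z < - d + t + b] and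
     [z - t < b - d]. *)
  - by apply: ltr_convex3 => //; lra.
  (* r beats other: [0 < d] by [hdc], and [0 < t + b] since [htz] gives [z + d < t + b]. *)
  - by apply: ltr_convex3 => //; lra.
  - by rewrite /u /u'; lra.
have [f22 o22] : s FLR (I2 FLR) act_f = 0 /\ s FLR (I2 FLR) act_other = 0.
  have := s_ge0 FLR (I2 FLR) act_f; have := s_ge0 FLR (I2 FLR) act_other.
  by split; lra.
have r12 : s LDR (I2 LDR) act_r = 1.
  have := collusion_best (I2 LDR) hseq.
  rewrite !utility_I2_LDR// !node_utility_v2 !node_utility_v3 !node_utility_v4.
  rewrite !node_utility_v5 !dfwithin !dfwithout//.
  rewrite r22 f22 o22 /collusion /payoff2 /= !mul0r !mul1r !add0r !addr0.
  (* [htz] gives [z - t - b < - d], while [b < c <= w] makes [w - b] positive. *)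
  apply: strict_best_reply3 => //; lra.
have [f12 o12] : s LDR (I2 LDR) act_f = 0 /\ s LDR (I2 LDR) act_other = 0.
  have := s_ge0 LDR (I2 LDR) act_f; have := s_ge0 LDR (I2 LDR) act_other.
  by split; lra.
have c21 : s FLR (I1 FLR) act_collude = 1.
  have := collusion_best (I1 FLR) hseq.
  (* The utilities at [v3] and [v5] stay folded: LDR's weights [f12] and [o12] cancel them, under
     FLR's deviation too. The final strict gap holds because [0 <= b < c] makes [c] positive. *)
  rewrite !utility_I1_FLR// !node_utility_v1 !node_utility_v2 !node_utility_v4.
  rewrite !dfwithin !dfwithout//.
  rewrite r22 f22 o22 r12 f12 o12 /collusion /payoff2 /=.
  rewrite !mul0r !mul1r !add0r !addr0.
  apply: strict_best_reply2 => //; lra.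
have i11 : s LDR (I1 LDR) act_init = 1.
  have := collusion_best (I1 LDR) hseq.
  rewrite !utility_I1_LDR// !node_utility_v0 !node_utility_v1 !node_utility_v2.
  rewrite !node_utility_v4 !dfwithin !dfwithout//.
  (* LDR's deviation leaves FLR's mixture at [v1] unchanged, so this weight occurs on both sides of
     the inequality. *)
  have nc21 : s FLR (I1 FLR) act_not_collude = 0 by lra.
  rewrite r22 f22 o22 r12 f12 o12 c21 nc21 /collusion /payoff2 /=.
  rewrite !mul0r !mul1r !add0r !addr0.
  apply: strict_best_reply2 => //; lra.
by rewrite reach_v10 i11 c21 r12 r22 !mulr1.
Qed.
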